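(* Let $n \ge 0$ be an integer and let $Y_n \subset \mathbb{R}^2$ be a $\Pi_n$-poised set. Then $Y_n$ contains a maximal line if and only if there exist a basis $h_0,\dots,h_{n+1}$ of the vector space $\Pi_{n+1} \cap I(Y_n)$ and a syzygy matrix $\Sigma \in \Pi_1^{(n+1)\times(n+2)}$ of rank $n+1$ for $(h_0,\dots,h_{n+1})$ (rows indexed by $1,\dots,n+1$, columns indexed by $0,\dots,n+1$) whose $j$-th column is of the form $k(x)\, e_i$ for some polynomial $k$ of degree $1$, some $i \in \{1,\dots,n+1\}$ and some $j \in \{0,\dots,n+1\}$. Moreover, the polynomial $k$ determines the maximal line: for such a matrix, $V(k)=\{x\in\mathbb{R}^2 : k(x)=0\}$ is a maximal line of $Y_n$.
   Context: $\Pi=\mathbb{R}[x_1,x_2]$ is the ring of real bivariate polynomials, and $\Pi_n$ is the vector space of polynomials in $\Pi$ of total degree at most $n$, of dimension $(n+1)(n+2)/2$. For $Y\subseteq\mathbb{R}^2$, $I(Y)=\{p\in\Pi : p(y)=0 \text{ for all } y\in Y\}$. A finite set $Y\subset\mathbb{R}^2$ is $\Pi_n$-poised if for every $f\in\mathbb{R}^Y$ there is a unique $p\in\Pi_n$ with $p(y)=f(y)$ for all $y\in Y$. A line is the zero set in $\mathbb{R}^2$ of a polynomial of degree $1$. A $\Pi_n$-poised set $Y_n$ contains a maximal line $K$ if $K$ is a line with $\#(Y_n\cap K)=n+1$. A syzygy of $(p_0,\dots,p_{n+1})\in\Pi^{n+2}$ is a tuple $(\sigma_0,\dots,\sigma_{n+1})\in\Pi^{n+2}$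 with $\sum_{i=0}^{n+1}\sigma_i p_i=0$. A syzygy matrix $\Sigma\in\Pi_1^{(n+1)\times(n+2)}$ for $(h_0,\dots,h_{n+1})$ is a matrix with entries in $\Pi_1$ each of whose rows is a syzygy of $(h_0,\dots,h_{n+1})$; its rank is understood over the field of rational functions $\mathbb{R}(x_1,x_2)$. $e_i$ denotes the $i$-th standard unit vector of $\mathbb{R}^{n+1}$. *)

(* Defs.v *)
From HB Require Import structures.
From mathcomp Require Import all_boot all_order all_algebra.
From mathcomp Require Import finmap boolp classical_sets reals.
From mathcomp Require Import mpoly.

Set Implicit Arguments.
Unset Strict Implicit.
Unset Printing Implicit Defensive.

Import GRing.Theory Num.Theory.

Local Open Scope ring_scope.
Local Open Scope classical_set_scope.

Notation plane R := 'rV[R]_2.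
Notation bipoly R := {mpoly R[2]}.

Section Defs.
Variable R : realType.

Definition peval (p : bipoly R) (x : plane R) : R := p.@[x 0].

(* [msize p] is the total degree of [p] plus one, and 0 for [p = 0]. *)
Definition Pi_ (n : nat) : set (bipoly R) := [set p | (msize p <= n.+1)%N].

Definition degree1 (p : bipoly R) : Prop := msize p = 2.

Definition vanishing_ideal (Y : set (plane R)) : set (bipoly R) :=
  [set p | forall y, Y y -> peval p y = 0].

Definition zero_set (p : bipoly R) : set (plane R) := [set x | peval p x = 0].

Definition poised (n : nat) (Y : {fset plane R}) : Prop :=
  forall f : {ffun Y -> R},
    exists! p : bipoly R, Pi_ n p /\ forall y : Y, peval p (val y) = f y.

Definition is_line (K : set (plane R)) : Prop :=
  exists2 k : bipoly R, degree1 k & K = zero_set k.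

Definition maximal_line (n : nat) (Y : {fset plane R}) (K : set (plane R)) :
    Prop :=
  is_line K /\ #|` [fset y in Y | y \in K]%fset| = n.+1.

Definition is_basis (L : lmodType R) (V : set L) (m : nat) (b : 'I_m -> L) :
    Prop :=
  [/\ forall i, V (b i),
      forall c : 'I_m -> R, \sum_i c i *: b i = 0 -> forall i, c i = 0
    & forall v, V v -> exists c : 'I_m -> R, v = \sum_i c i *: b i].

Definition syzygy (m : nat) (p s : 'I_m -> bipoly R) : Prop :=
  \sum_i s i * p i = 0.

Definition syzygy_matrix (m q : nat) (p : 'I_q -> bipoly R)
    (Sigma : 'M[bipoly R]_(m, q)) : Prop :=
  (forall i j, Pi_ 1 (Sigma i j)) /\ (forall i, syzygy p (Sigma i)).

Definition frac_rank (m q : nat) (Sigma : 'M[bipoly R]_(m, q)) : nat :=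
  \rank (map_mx (@tofrac (bipoly R)) Sigma).

(* The data on the right-hand side of the equivalence: the column of index [j]
   of [Sigma] is [k e_i]. *)
Definition maximal_line_certificate (n : nat) (Y : {fset plane R})
    (h : 'I_n.+2 -> bipoly R) (Sigma : 'M[bipoly R]_(n.+1, n.+2))
    (k : bipoly R) (i : 'I_n.+1) (j : 'I_n.+2) : Prop :=
  [/\ is_basis (Pi_ n.+1 `&` vanishing_ideal [set` Y]) h,
      syzygy_matrix h Sigma,
      frac_rank Sigma = n.+1,
      degree1 k
    & col j Sigma = k *: delta_mx i 0].

End Defs.

(* Main.v *)
(* Let h be a basis of Pi_(n+1) /\ I(Y), and let u be the vector of signed
   maximal minors of Sigma, of degree at most n+1.  Both h and u span the kernel
   of Sigma, so u_l h_m = u_m h_l.  The span of h contains elements with leading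
   monomials x_0^(n+1) and x_1^(n+1); as these are coprime and u has degree at
   most n+1, u is a constant multiple of h.  If the column of index j is k e_i,
   then k divides every minor u_l with l <> j, hence h_l = k q_l.  The n+1
   independent polynomials q_l of degree n vanish on Y off the line V(k), so
   Y meets V(k) in at least n+1 points; the reverse inequality holds because
   k p = 0 whenever p has degree less than n and vanishes on Y off V(k).

   Conversely, if V(k) contains n+1 points of Y, the set Z of the other points
   is Pi_(n-1)-poised.  Let q_l vanish on Z with leading form
   x_0^l x_1^(n-l).  Then the k q_l together with one more h_0 form a basis of
   Pi_(n+1) /\ I(Y), the q_l have linear syzygies coming from
   x_1 q_(l+1) - x_0 q_l, and h_0 = sum_l s_l q_l with s_l linear gives the
   syzygy k h_0 = sum_l s_l (k q_l), whose coefficient k is alone in its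
   column. *)
Require Import Defs.
From HB Require Import structures.
From mathcomp Require Import all_boot all_order all_algebra.
From mathcomp Require Import finmap boolp classical_sets reals.
From mathcomp Require Import mpoly.

Set Implicit Arguments.
Unset Strict Implicit.
Unset Printing Implicit Defensive.

(** * Linear algebra: evaluation matrices and maximal minors *)

Section LinearAlgebra.
Import GRing.Theory.
Local Open Scope ring_scope.

(** Since [A] has rank n, its row space misses some unit vector, and adjoining that vector raises
    the rank to n+1. This serves both to find a nonzero minor and to extend the [k q_l] to a
    basis. *)
Lemma row_free_complete (F : fieldType) n (A : 'M[F]_(n, n.+1)) :
  row_free A ->
  exists w : 'rV_n.+1, (col_mx w A : 'M_n.+1) \in unitmx.
Proof.
move=> /eqP rkA.
have : ~~ (1%:M <= A)%MS by rewrite sub1mx /row_full rkA ltn_eqF.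
move=> /row_subPn[i nA]; exists (row i 1%:M).
rewrite -row_full_unit -col_leq_rank.
suff /rank_ltmx : (A < row i 1%:M + A)%MS by rewrite rkA addsmxE.
by rewrite ltmxE addsmxSr /= addsmx_sub negb_and nA.
Qed.

Section Evaluation.
Variables (F : fieldType) (I T : finType) (e : I -> T -> F).

(** Injectivity and, below, surjectivity of the map from coefficients to values. Arbitrary finite
    index types let bounded monomials and points of a finite set serve directly. *)
Definition ev_free :=
  forall c : I -> F, (forall t, \sum_i c i * e i t = 0) -> forall i, c i = 0.
Definition ev_full :=
  forall f : T -> F, exists c : I -> F, forall t, \sum_i c i * e i t = f t.

Let E := \matrix_(i < #|I|, j < #|T|) e (enum_val i) (enum_val j).

Lemma sum_mulmx (v : 'rV_#|I|) t :
  \sum_i v 0 (enum_rank i) * e i t = (v *m E) 0 (enum_rank t).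
Proof.
rewrite mxE (reindex enum_rank) /=; last exact/onW_bij/enum_rank_bij.
by apply: eq_bigr => i _; rewrite mxE !enum_rankK.
Qed.

Lemma ev_free_row_free : ev_free -> row_free E.
Proof.
move=> fr; apply: inj_row_free => v vE.
apply/rowP => i; rewrite mxE -(enum_valK i).
apply: (fr (fun i => v 0 (enum_rank i))) => t.
by rewrite sum_mulmx vE mxE.
Qed.

Lemma ev_free_card : ev_free -> (#|I| <= #|T|)%N.
Proof. by move=> /ev_free_row_free /eqP <-; apply: rank_leq_col. Qed.

Lemma ev_full_card : ev_full -> (#|T| <= #|I|)%N.
Proof.
move=> fu; suff : row_full E.
  by rewrite /row_full => /eqP <-; apply: rank_leq_row.
rewrite -sub1mx; apply/row_subP => j.
have [c cE] := fu (fun t => (t == enum_val j)%:R).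
apply/submxP; exists (\row_i c (enum_val i)); apply/rowP => l.
rewrite -(enum_valK l) -sum_mulmx.
under eq_bigr do rewrite mxE enum_rankK.
by rewrite cE !mxE enum_valK (inj_eq enum_val_inj) eq_sym.
Qed.

Lemma ev_free_full : ev_free -> (#|T| <= #|I|)%N -> ev_full.
Proof.
move=> fr le_TI f; have eqTI : #|T| = #|I|.
  by apply/eqP; rewrite eqn_leq le_TI ev_free_card.
have /row_fullP[B BE] : row_full E.
  by have /eqP rkE := ev_free_row_free fr; rewrite /row_full rkE eqTI.
pose v := (\row_j f (enum_val j)) *m B.
exists (fun i => v 0 (enum_rank i)) => t.
by rewrite sum_mulmx -mulmxA BE mulmx1 mxE enum_rankK.
Qed.

End Evaluation.

Section Minors.
Variable A : comNzRingType.

(** The sign is that of the cofactor along a row adjoined on top of [S]. *)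
Definition maxminor n (S : 'M[A]_(n, n.+1)) (l : 'I_n.+1) : A :=
  (-1) ^+ l * \det (col' l S).

Lemma cofactor_col_mx n (w : 'rV_n.+1) (S : 'M[A]_(n, n.+1)) l :
  cofactor (col_mx w S : 'M_n.+1) 0 l = maxminor S l.
Proof.
rewrite /cofactor /maxminor; congr (_ * \det _).
apply/matrixP => i j; rewrite !mxE.
case: splitP => [i'|i']; first by rewrite ord1.
by rewrite /= /bump /= => -[/val_inj ->].
Qed.

Lemma det_col_mx n (w : 'rV_n.+1) (S : 'M[A]_(n, n.+1)) :
  \det (col_mx w S : 'M_n.+1) = \sum_l w 0 l * maxminor S l.
Proof.
rewrite (expand_det_row _ 0); apply: eq_bigr => l _.
rewrite cofactor_col_mx; congr (_ * _).
by rewrite mxE; case: splitP => // i' _; rewrite ord1.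
Qed.

(* Multiply [col_mx (delta_mx 0 m) S *m h = h m 0 *: delta_mx 0 0] by the
   adjugate, whose first column consists of the maximal minors of [S]. *)
Lemma maxminor_cross n (S : 'M[A]_(n, n.+1)) (h : 'cV_n.+1) :
  S *m h = 0 -> forall l m, maxminor S l * h m 0 = maxminor S m * h l 0.
Proof.
move=> Sh l m; pose B : 'M_n.+1 := col_mx (delta_mx 0 m : 'rV_n.+1) S.
have Bh : B *m h = h m 0 *: delta_mx 0 0.
  rewrite [LHS](@mul_col_mx _ 1 n) Sh -rowE; apply/colP => i; rewrite !mxE.
  case: splitP => i' iE; rewrite !mxE -val_eqE /= iE ?mulr0 //.
  by rewrite (ord1 i') mulr1.
have := congr1 (fun X => (\adj B *m X) l 0) Bh.
rewrite mulmxA mul_adj_mx mul_scalar_mx -scalemxAr -colE !mxE.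
rewrite cofactor_col_mx det_col_mx (bigD1 m) //= big1; last first.
  by move=> i /negPf nim; rewrite mxE nim andbF mul0r.
by rewrite mxE !eqxx mul1r addr0 [RHS]mulrC.
Qed.

(** Deleting another column leaves the column [k e_i] in place, and expanding along it leaves one
    term. *)
Lemma maxminor_col n (S : 'M[A]_(n.+1, n.+2)) (k : A) i j l :
  col j S = k *: delta_mx i 0 -> l != j ->
  exists2 j', lift l j' = j &
    maxminor S l = k * ((-1) ^+ l * cofactor (col' l S) i j').
Proof.
move=> /colP Sj /unlift_some[j' jE _]; exists j' => //.
have Srj r : col' l S r j' = k * (r == i)%:R.
  by rewrite mxE -jE; have := Sj r; rewrite !mxE andbT.
rewrite /maxminor (expand_det_col _ j') (bigD1 i) //= big1; last first.
  by move=> r /negPf rNi; rewrite Srj rNi mulr0 mul0r.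
by rewrite Srj eqxx mulr1 addr0 mulrCA.
Qed.

End Minors.

(** Over the fraction field the rows extend to an invertible matrix. Its determinant, expanded along
    the added row, is a combination of the maximal minors. *)
Lemma maxminor_neq0 (D : idomainType) n (S : 'M[D]_(n, n.+1)) :
  \rank (map_mx (@tofrac D) S) = n -> exists l, maxminor S l != 0.
Proof.
move=> rkS; have [|w] := @row_free_complete _ _ (map_mx (@tofrac D) S).
  by rewrite /row_free rkS.
rewrite unitmxE unitfE det_col_mx => dN0.
apply/existsP; apply: contra_neqT dN0 => /existsPn S0.
apply: big1 => l _; rewrite /maxminor -map_col' det_map_mx.
have := S0 l; rewrite negbK mulf_eq0 signr_eq0 /= => /eqP ->.
by rewrite rmorph0 !mulr0.
Qed.

End LinearAlgebra.

(** * Bivariate monomials and degree bounds *)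

Section Polynomials.
Import GRing.Theory.
Local Open Scope ring_scope.

Definition bimon (a b : nat) : 'X_{1..2} := (U_(0%R) *+ a + U_(1%R) *+ b)%MM.

Lemma bimonE (m : 'X_{1..2}) : m = bimon (m 0) (m 1).
Proof.
rewrite [LHS]multinomUE_id big_ord_recl big_ord1.
by congr (U_(_) *+ m _ + U_(_) *+ m _)%MM; apply: val_inj.
Qed.

Lemma bimon0 a b : bimon a b 0 = a.
Proof. by rewrite mnmDE !mulmnE !mnm1E /= mul1n mul0n addn0. Qed.

Lemma mdeg_bimon a b : mdeg (bimon a b) = (a + b)%N.
Proof. by rewrite mdegD !mdegMn !mdeg1 !mul1n. Qed.

Lemma bimonS0 a b : (U_(0%R) + bimon a b)%MM = bimon a.+1 b.
Proof. by rewrite /bimon mulmS addmA. Qed.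

Lemma bimonS1 a b : (U_(1%R) + bimon a b)%MM = bimon a b.+1.
Proof. by rewrite /bimon mulmS addmA [(_ + _ *+ a)%MM]addmC addmA. Qed.

Lemma bimon_mdeg (m : 'X_{1..2}) : m = bimon (m 0) (mdeg m - m 0).
Proof.
by rewrite [in mdeg m](bimonE m) mdeg_bimon addKn -bimonE.
Qed.

Lemma mdeg_bimon_ord d (l : 'I_d.+1) : mdeg (bimon l (d - l)) = d.
Proof. by rewrite mdeg_bimon subnKC // -ltnS. Qed.

Lemma mdeg_ordP d (m : 'X_{1..2}) :
  mdeg m = d -> exists l : 'I_d.+1, m = bimon l (d - l).
Proof.
move=> md; have lt_d : (m 0%R < d.+1)%N.
  by rewrite ltnS -md [in mdeg m](bimonE m) mdeg_bimon leq_addr.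
by exists (Ordinal lt_d); rewrite /= -md -bimon_mdeg.
Qed.

(** The new monomials are those of degree exactly d, indexed by their exponent in [X_0]. This
    increment replaces the closed formula for the dimension. *)
Lemma card_bimonS d : #|{: 'X_{1..2 < d.+1}}| = (#|{: 'X_{1..2 < d}}| + d.+1)%N.
Proof.
pose f (s : 'X_{1..2 < d} + 'I_d.+1) : 'X_{1..2} :=
  match s with inl m => m | inr l => bimon l (d - l) end.
have f_lt s : (mdeg (f s) < d.+1)%N.
  by case: s => [m|l] /=; rewrite ?mdeg_bimon_ord // ltnW // ltnS bmdeg.
pose g s : 'X_{1..2 < d.+1} := BMultinom (f_lt s).
have g_bij : bijective g.
  pose g' (m : 'X_{1..2 < d.+1}) : 'X_{1..2 < d} + 'I_d.+1 :=
    if insub (val m) is Some m' then inl m' else inr (inord (val m 0)).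
  exists g' => [[m|l]|m]; rewrite /g' /g /=.
  - by rewrite valK.
  - rewrite insubF ?mdeg_bimon_ord ?ltnn //.
    by congr inr; apply: val_inj; rewrite /= bimon0 inordK.
  - apply: val_inj; rewrite /=; case: insubP => [m' _ //|/=].
    rewrite -leqNgt => ged; have md : mdeg m = d.
      by apply/eqP; rewrite eqn_leq ged -ltnS bmdeg.
    have [l mE] := mdeg_ordP md.
    by rewrite mE bimon0 inordK.
by rewrite -(bij_eq_card g_bij) card_sum card_ord.
Qed.

Section Size.
Variables (n : nat) (R : nzRingType).
Implicit Types p q : {mpoly R[n]}.

Lemma msize_leP p d :
  reflect (forall m, (d <= mdeg m)%N -> p@_m = 0) (msize p <= d)%N.
Proof.
apply: (iffP idP) => [le_pd m le_dm|p0].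
  by apply/memN_msupp_eq0/msize_mdeg_ge/(leq_trans le_pd).
rewrite msizeE; apply/bigmax_leqP_seq => m; rewrite mcoeff_msupp => pm _.
by rewrite ltnNge; apply: contra pm => /p0 ->.
Qed.

Lemma msize_leD p q d :
  (msize p <= d)%N -> (msize q <= d)%N -> (msize (p + q) <= d)%N.
Proof.
by move=> pd qd; rewrite (leq_trans (msizeD_le _ _)) // geq_max pd.
Qed.

Lemma msize_leB p q d :
  (msize p <= d)%N -> (msize q <= d)%N -> (msize (p - q) <= d)%N.
Proof. by move=> pd qd; rewrite msize_leD ?msizeN. Qed.

Lemma msize_leZ c p d : (msize p <= d)%N -> (msize (c *: p) <= d)%N.
Proof. exact/leq_trans/msizeZ_le. Qed.

Lemma msize_le_sum (I : finType) (F : I -> {mpoly R[n]}) d :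
  (forall i, msize (F i) <= d)%N -> (msize (\sum_i F i) <= d)%N.
Proof.
by move=> Fd; elim/big_rec: _ => [|i p _]; rewrite ?msize0 //; apply: msize_leD.
Qed.

End Size.

Section SizeDomain.
Variables (n : nat) (D : idomainType).
Implicit Types p q : {mpoly D[n]}.

Lemma msize_leM p q a b :
  (msize p <= a.+1)%N -> (msize q <= b.+1)%N -> (msize (p * q) <= (a + b).+1)%N.
Proof.
have [->|p0] := eqVneq p 0; first by rewrite mul0r msize0.
have [->|q0] := eqVneq q 0; first by rewrite mulr0 msize0.
by move=> pa qb; rewrite msizeM // -subn1 leq_subLR add1n -addSn -addnS leq_add.
Qed.

End SizeDomain.
End Polynomials.

(** * Interpolation, and bases of vanishing polynomials with prescribed leading forms *)

Section Interpolation.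
Import GRing.Theory.
Local Open Scope ring_scope.
Variable R : realType.
Implicit Types (p q f : bipoly R) (Z : {fset plane R}) (d : nat).

Local Notation ideal Z := (vanishing_ideal [set` Z]).

Lemma peval_sum (I : finType) (c : I -> R) (b : I -> bipoly R) x :
  peval (\sum_i c i *: b i) x = \sum_i c i * peval (b i) x.
Proof. by rewrite /peval raddf_sum; apply: eq_bigr => i _; apply: mevalZ. Qed.

Lemma pevalM p q x : peval (p * q) x = peval p x * peval q x.
Proof. exact: mevalM. Qed.

Lemma pevalB p q x : peval (p - q) x = peval p x - peval q x.
Proof. exact: mevalB. Qed.

Lemma vanishingB (S : set (plane R)) p q :
  vanishing_ideal S p -> vanishing_ideal S q -> vanishing_ideal S (p - q).
Proof. by move=> pS qS y Sy; rewrite pevalB pS // qS // subr0. Qed.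

Lemma vanishingM (S : set (plane R)) p q :
  vanishing_ideal S q -> vanishing_ideal S (p * q).
Proof. by move=> qS y Sy; rewrite pevalM qS // mulr0. Qed.

Lemma vanishing_sum (S : set (plane R)) (I : finType) (c : I -> R)
    (b : I -> bipoly R) :
  (forall i, vanishing_ideal S (b i)) ->
  vanishing_ideal S (\sum_i c i *: b i).
Proof.
by move=> bS y Sy; rewrite peval_sum big1 // => i _; rewrite bS ?mulr0.
Qed.

(** The value vectors of the [b i] are independent in the space of functions on [Z], whose dimension
    is the number of points. *)
Lemma card_ge_free (I : finType) (b : I -> bipoly R) Z :
  (forall c : I -> R, ideal Z (\sum_i c i *: b i) -> forall i, c i = 0) ->
  (#|I| <= #|` Z|)%N.
Proof.
move=> fr; rewrite cardfE.
apply: (@ev_free_card R I Z (fun i z => peval (b i) (val z))) => c c0.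
apply: fr => y yZ; rewrite peval_sum; exact: (c0 [` yZ]%fset).
Qed.

Lemma mcoeff_bmpoly d (c : 'X_{1..2 < d} -> R) (m : 'X_{1..2 < d}) :
  (\sum_i c i *: 'X_[i] : bipoly R)@_m = c m.
Proof.
rewrite raddf_sum (bigD1 m) //= mcoeffZ mcoeffX eqxx mulr1 big1 ?addr0 // => i.
by rewrite mcoeffZ mcoeffX => /negPf; rewrite -val_eqE /= => ->; rewrite mulr0.
Qed.

Lemma msize_bmpoly d (c : 'X_{1..2 < d} -> R) :
  (msize (\sum_i c i *: 'X_[i] : bipoly R) <= d)%N.
Proof.
by apply: msize_le_sum => i; apply: msize_leZ; rewrite msizeX bmdeg.
Qed.

(* Poisedness for polynomials of degree less than [d], so that [d = 0] covers the
   empty set. *)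
Definition unisolvent d Z : Prop :=
  (forall p, (msize p <= d)%N -> ideal Z p -> p = 0) /\
  (forall f : plane R -> R,
     exists2 p, (msize p <= d)%N & forall z, z \in Z -> peval p z = f z).

Lemma card_ge_inj d Z :
  (forall p, (msize p <= d)%N -> ideal Z p -> p = 0) ->
  (#|{: 'X_{1..2 < d}}| <= #|` Z|)%N.
Proof.
move=> inj; apply: (@card_ge_free _ (fun m : 'X_{1..2 < d} => 'X_[m])).
by move=> c /(inj _ (msize_bmpoly c)) c0 i; rewrite -mcoeff_bmpoly c0 mcoeff0.
Qed.

(** An injective evaluation map into a space of no larger dimension is surjective. *)
Lemma unisolvent_inj d Z :
  (forall p, (msize p <= d)%N -> ideal Z p -> p = 0) ->
  (#|` Z| <= #|{: 'X_{1..2 < d}}|)%N -> unisolvent d Z.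
Proof.
move=> inj leZ; split=> // f.
pose e (m : 'X_{1..2 < d}) (z : Z) : R := peval 'X_[m] (val z).
have [||c cE] := @ev_free_full _ _ _ e _ _ (fun z => f (val z)).
- move=> c c0 i.
  rewrite -(mcoeff_bmpoly c) (inj _ (msize_bmpoly c)) ?mcoeff0 //.
  by move=> y yZ; rewrite peval_sum; exact: (c0 [` yZ]%fset).
- by rewrite -cardfE.
exists (\sum_i c i *: 'X_[i]); first exact: msize_bmpoly.
by move=> z zZ; rewrite peval_sum; exact: (cE [` zZ]%fset).
Qed.

Lemma unisolvent_card d Z :
  unisolvent d Z -> #|` Z| = #|{: 'X_{1..2 < d}}|.
Proof.
move=> [inj surj]; apply/eqP; rewrite eqn_leq card_ge_inj // andbT cardfE.
pose e (m : 'X_{1..2 < d}) (z : Z) : R := peval 'X_[m] (val z).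
apply: (@ev_full_card _ _ _ e) => f.
(* The data [f] live on [Z] only; the value 0 elsewhere is arbitrary. *)
have [p pd pE] := surj (fun x => if insub x is Some z then f z else 0).
exists (fun m : 'X_{1..2 < d} => p@_m) => z; have := pE _ (valP z).
by rewrite valK => <-; rewrite [in RHS](mpolywE pd) peval_sum.
Qed.

(** Uniqueness for zero data is injectivity. The bound shifts because [poised n] allows degree n,
    while [unisolvent] bounds the degree strictly. *)
Lemma poised_unisolvent n (Y : {fset plane R}) :
  poised n Y -> unisolvent n.+1 Y.
Proof.
move=> hY; split=> [p pn pY|f].
  have [q [_ qU]] := hY [ffun=> 0].
  rewrite -(qU p) ?(qU 0) //.
    by split=> [|y]; rewrite /Pi_ /= ?msize0 // /peval meval0 ffunE.
  by split=> // y; rewrite ffunE pY //= (valP y).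
have [q [[qn qE] _]] := hY [ffun y => f (val y)].
by exists q => // z zY; rewrite (qE [` zY]%fset) ffunE.
Qed.

(** The leading forms run through all monomials of degree d, so the coordinates of a combination are
    its coefficients in degree d. *)
Definition leading_family d Z (q : 'I_d.+1 -> bipoly R) : Prop :=
  forall l, ideal Z (q l) /\ (msize (q l - 'X_[bimon l (d - l)]) <= d)%N.

Lemma leading_family_ex d Z :
  unisolvent d Z -> exists q : 'I_d.+1 -> bipoly R, leading_family Z q.
Proof.
move=> [_ surj].
have /choice[q qP] : forall l : 'I_d.+1, exists p,
    ideal Z p /\ (msize (p - 'X_[bimon l (d - l)]) <= d)%N.
  (* The monomial minus its interpolant [r] of lower degree vanishes on [Z]. *)
  move=> l; have [r rd rE] := surj (peval 'X_[bimon l (d - l)]).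
  exists ('X_[bimon l (d - l)] - r); split.
    by move=> y yZ; rewrite pevalB rE // subrr.
  by rewrite addrAC subrr add0r msizeN.
by exists q.
Qed.

Lemma leading_family_msize d Z (q : 'I_d.+1 -> bipoly R) :
  leading_family Z q -> forall l, (msize (q l) <= d.+1)%N.
Proof.
move=> qP l; rewrite -(subrK 'X_[bimon l (d - l)] (q l)) msize_leD //.
  by have [_ /leqW] := qP l.
by rewrite msizeX mdeg_bimon_ord.
Qed.

Lemma leading_family_coef d Z (q : 'I_d.+1 -> bipoly R) :
  leading_family Z q ->
  forall l i : 'I_d.+1, (q l)@_(bimon i (d - i)) = (l == i)%:R.
Proof.
move=> qP l i; have [_ /msize_leP/(_ (bimon i (d - i)))] := qP l.
rewrite mdeg_bimon_ord leqnn => /(_ isT)/eqP.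
rewrite mcoeffB mcoeffX subr_eq0 => /eqP ->; congr ((nat_of_bool _)%:R).
apply/eqP/eqP => [/(congr1 (fun m : 'X_{1..2} => m 0))|-> //].
by rewrite !bimon0 => /val_inj.
Qed.

Lemma leading_family_coef_sum d Z (q : 'I_d.+1 -> bipoly R) :
  leading_family Z q -> forall (c : 'I_d.+1 -> R) (i : 'I_d.+1),
  (\sum_l c l *: q l)@_(bimon i (d - i)) = c i.
Proof.
move=> qP c i; rewrite raddf_sum (bigD1 i) //= mcoeffZ (leading_family_coef qP).
rewrite eqxx mulr1 big1 ?addr0 // => l /negPf li.
by rewrite mcoeffZ (leading_family_coef qP) li mulr0.
Qed.

Lemma leading_family_reduce d Z (q : 'I_d.+1 -> bipoly R) f :
  leading_family Z q -> (msize f <= d.+1)%N ->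
  (msize (f - \sum_(l < d.+1) f@_(bimon l (d - l)) *: q l) <= d)%N.
Proof.
move=> qP fd; set g := \sum_l _.
have gd : (msize (f - g) <= d.+1)%N.
  apply: msize_leB => //; apply: msize_le_sum => l.
  exact/msize_leZ/leading_family_msize/qP.
apply/msize_leP => m; rewrite leq_eqVlt => /predU1P[/esym md|]; last first.
  by move/msize_leP : gd; apply.
have [l ->] := mdeg_ordP md.
by rewrite mcoeffB (leading_family_coef_sum qP) subrr.
Qed.

(** Removing the part of degree d leaves a polynomial of degree less than d vanishing on [Z], hence
    zero. *)
Lemma leading_family_span d Z (q : 'I_d.+1 -> bipoly R) f :
  unisolvent d Z -> leading_family Z q -> (msize f <= d.+1)%N -> ideal Z f ->
  f = \sum_(l < d.+1) f@_(bimon l (d - l)) *: q l.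
Proof.
move=> [inj _] qP fd fZ; apply/subr0_eq/inj; first exact: leading_family_reduce.
by apply: vanishingB => //; apply: vanishing_sum => l; have [] := qP l.
Qed.

Lemma leading_family_basis d Z (q : 'I_d.+1 -> bipoly R) :
  unisolvent d Z -> leading_family Z q ->
  is_basis (Pi_ d `&` ideal Z)%classic q.
Proof.
move=> Zd qP; split=> [l|c c0 l|v [vd vZ]].
- by split; [exact: (leading_family_msize qP) | have [] := qP l].
- by rewrite -(leading_family_coef_sum qP) c0 mcoeff0.
- exists (fun l : 'I_d.+1 => v@_(bimon l (d - l))).
  exact: (leading_family_span Zd qP).
Qed.

(** Multiplying by [X_0] reaches every leading monomial of degree d+1 except the pure power of
    [X_1], which comes from [X_1 * q 0]. *)
Definition raise_family d (q : 'I_d.+1 -> bipoly R) (l : 'I_d.+2) : bipoly R :=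
  if unlift 0 l is Some l' then 'X_0 * q l' else 'X_1 * q 0.

Lemma leading_family_shift d Z (q : 'I_d.+1 -> bipoly R) (i : 'I_2)
    (l : 'I_d.+1) m :
  leading_family Z q -> (U_(i) + bimon l (d - l))%MM = m ->
  ideal Z ('X_i * q l) /\ (msize ('X_i * q l - 'X_[m]) <= d.+1)%N.
Proof.
move=> qP <-; have [qZ ql] := qP l; split; first exact: vanishingM.
rewrite mpolyXD -mulrBr.
have [->|r0] := eqVneq (q l - 'X_[bimon l (d - l)]) 0.
  by rewrite mulr0 msize0.
by rewrite msizeM // -?msize_poly_eq0 msizeX ?mdeg1.
Qed.

Lemma leading_family_raise d Z (q : 'I_d.+1 -> bipoly R) :
  leading_family Z q -> leading_family Z (raise_family q).
Proof.
move=> qP l; rewrite /raise_family.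
case: unliftP => [l'|] ->; apply: leading_family_shift => //.
  by rewrite bimonS0 subSS.
by rewrite bimonS1 !subn0.
Qed.

(** The raised family removes the part of degree d+1; the remainder is a combination of the [q l]
    with constant coefficients. *)
Lemma leading_family_spanS d Z (q : 'I_d.+1 -> bipoly R) f :
  unisolvent d Z -> leading_family Z q -> (msize f <= d.+2)%N -> ideal Z f ->
  exists2 s : 'I_d.+1 -> bipoly R,
    forall l, (msize (s l) <= 2)%N & f = \sum_l s l * q l.
Proof.
move=> Zd qP fd fZ; have QP := leading_family_raise qP.
have := leading_family_reduce QP fd.
set c := fun l : 'I_d.+2 => f@_(bimon l (d.+1 - l)).
rewrite -/(c _); set g := \sum_l _ => gd.
have gZ : ideal Z (f - g).
  by apply: vanishingB => //; apply: vanishing_sum => l; have [] := QP l.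
set r := fun l : 'I_d.+1 => (f - g)@_(bimon l (d - l)).
(* The constant [r l] comes from the remainder, the linear terms from the members of the raised
   family that are multiples of [q l]. *)
exists (fun l => (r l)%:MP + (c (lift 0 l) *: 'X_0 +
   (if l == 0 then c 0 *: 'X_1 else 0))).
  move=> l; rewrite !msize_leD //.
  - by rewrite msizeC; case: eqP.
  - by rewrite msize_leZ // msizeX mdeg1.
  - by case: eqP; rewrite ?msize0 // msize_leZ // msizeX mdeg1.
rewrite -[LHS](subrK g) [X in X + _](leading_family_span Zd qP gd gZ) -/(r _).
under [RHS]eq_bigr do rewrite mulrDl mul_mpolyC.
rewrite big_split; congr (_ + _).
rewrite /g big_ord_recl /raise_family unlift_none.
under [RHS]eq_bigr do rewrite mulrDl.
rewrite big_split addrC; congr (_ + _).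
  by apply: eq_bigr => l _; rewrite liftK scalerAl.
rewrite (bigD1 0) //= big1 ?addr0 ?scalerAl // => l /negPf ->.
by rewrite mul0r.
Qed.

(* The syzygy of row [i] comes from [X_1 q_(i+1)] and [X_0 q_i] having the same
   leading form. *)
Lemma leading_family_syzygy d Z (q : 'I_d.+1 -> bipoly R) :
  unisolvent d Z -> leading_family Z q ->
  exists C : 'M[R]_(d, d.+1),
    forall i, \sum_(l < d.+1)
      ('X_1 *+ (l == lift 0 i) - 'X_0 *+ (l == widen_ord (leqnSn d) i)
       - (C i l)%:MP) * q l = 0.
Proof.
move=> Zd qP; have QP := leading_family_raise qP.
pose w (i : 'I_d) := widen_ord (leqnSn d) i.
pose f i := 'X_1 * q (lift 0 i) - 'X_0 * q (w i).
exists (\matrix_(i, l) (f i)@_(bimon l (d - l))) => i.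
have fE : f i = \sum_(l < d.+1) (f i)@_(bimon l (d - l)) *: q l.
  pose m := bimon i.+1 (d - i).
  have [|X1Z X1d] := @leading_family_shift _ _ _ 1 (lift 0 i) m qP.
    by rewrite bimonS1 subnSK.
  have [|X0Z X0d] := @leading_family_shift _ _ _ 0 (w i) m qP.
    by rewrite bimonS0.
  apply: (leading_family_span Zd qP); last exact: vanishingB.
  by rewrite /f -(subrKA 'X_[m]) msize_leD // -opprB msizeN.
under eq_bigr do rewrite mulrBl mxE mul_mpolyC.
rewrite sumrB -fE; apply/eqP; rewrite subr_eq0; apply/eqP.
under eq_bigr do rewrite mulrBl.
rewrite sumrB; congr (_ - _).
  rewrite (bigD1 (lift 0 i)) //= eqxx big1 ?addr0 // => l /negPf ->.
  by rewrite mul0r.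
rewrite (bigD1 (w i)) //= eqxx big1 ?addr0 // => l /negPf ->.
by rewrite mul0r.
Qed.

End Interpolation.

(** * Counting the points of a poised set on and off a line *)

Section MaximalLines.
Import GRing.Theory.
Local Open Scope ring_scope.
Variable R : realType.
Implicit Types (p q f k : bipoly R) (Y Z : {fset plane R}).

Local Notation ideal Z := (vanishing_ideal [set` Z]).
Local Notation on_line Y k := [fset y in Y | y \in zero_set k]%fset.

Lemma in_on_line Y k y :
  (y \in on_line Y k) = (y \in Y) && (peval k y == 0).
Proof.
rewrite !inE /=; congr (_ && _).
by apply/idP/eqP => [|k0]; rewrite ?inE.
Qed.

Lemma degree1_neq0 k : degree1 k -> k != 0.
Proof. by move=> k2; rewrite -msize_poly_eq0 k2. Qed.

(** The product [k * p] vanishes on all of [Y] and has degree at most n, so it is zero. *)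
Lemma off_line_inj n Y k :
  unisolvent n.+1 Y -> degree1 k ->
  forall p, (msize p <= n)%N -> ideal (Y `\` on_line Y k)%fset p -> p = 0.
Proof.
move=> [inj _] k2 p pn pZ; have k0 := degree1_neq0 k2.
have [//|p0] := eqVneq p 0.
suff /eqP : k * p = 0 by rewrite mulf_eq0 (negPf k0) => /eqP.
apply: inj => [|y /= yY]; first by rewrite msizeM // k2.
rewrite pevalM; have [->|ky] := eqVneq (peval k y) 0; first by rewrite mul0r.
by rewrite pZ ?mulr0 //= in_fsetD in_on_line yY (negPf ky).
Qed.

Lemma card_off_line Y k :
  (#|` on_line Y k| + #|` (Y `\` on_line Y k)%fset|)%N = #|` Y|.
Proof.
rewrite -[RHS](cardfsID (on_line Y k)) (fsetIidPr _) //.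
by apply/fsubsetP => y; rewrite in_on_line => /andP[].
Qed.

(** At most n+1 points: the points off the line are at least as many as the monomials of degree less
    than n. At least n+1: each [q l] vanishes off the line, so a combination vanishing on the line
    points vanishes on [Y] and is zero. *)
Lemma card_on_line n Y k (q : 'I_n.+1 -> bipoly R) :
  unisolvent n.+1 Y -> degree1 k ->
  (forall l, (msize (q l) <= n.+1)%N) ->
  (forall c : 'I_n.+1 -> R, \sum_l c l *: q l = 0 -> forall l, c l = 0) ->
  (forall l, ideal Y (k * q l)) ->
  #|` on_line Y k| = n.+1.
Proof.
move=> hY k2 qn qfree kqY; apply/eqP; rewrite eqn_leq; apply/andP; split.
  rewrite -(leq_add2r #|` (Y `\` on_line Y k)%fset|) card_off_line.
  rewrite (unisolvent_card hY) card_bimonS addnC leq_add2l.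
  exact/card_ge_inj/(off_line_inj hY).
have -> : n.+1 = #|{: 'I_n.+1}| by rewrite card_ord.
apply: (@card_ge_free _ _ q) => c cK; apply: qfree.
have [inj _] := hY; apply: inj.
  by apply: msize_le_sum => l; apply: msize_leZ.
move=> y /= yY; have [ky|ky] := eqVneq (peval k y) 0.
  by apply: cK; rewrite /= in_on_line yY ky eqxx.
rewrite peval_sum big1 // => l _; have /eqP := kqY l y yY.
by rewrite pevalM mulf_eq0 (negPf ky) => /eqP ->; rewrite mulr0.
Qed.

(** * From a certificate to a maximal line *)

Lemma mlead_leading f (m : 'X_{1..2}) :
  (msize (f - 'X_[m]) <= mdeg m)%N -> f != 0 /\ mlead f = m.
Proof.
move=> fm; have mf : mlead f = m.
  rewrite -(subrK 'X_[m] f); have [->|r0] := eqVneq (f - 'X_[m]) 0.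
    by rewrite add0r mleadXm.
  (* The monomial order is graded, so a remainder of smaller degree stays below [m]. *)
  rewrite mleadDr mleadXm //; apply: lt_mdeg_ltmc.
  by rewrite mlead_deg.
split=> //; apply: contraTneq fm => ->.
by rewrite sub0r msizeN msizeX ltnn.
Qed.

(* Comparing leading monomials, a nonzero [u - c *: f] would have leading
   monomial divisible by [X_0 ^ d], hence equal to it, but [c] kills that
   coefficient. *)
Lemma cross_proportional d f g u v :
  f != 0 -> g != 0 -> mlead f = bimon d 0 -> mlead g = bimon 0 d ->
  (msize u <= d.+1)%N -> u * g = v * f -> exists c, u = c *: f.
Proof.
move=> f0 g0 fm gm ud ugvf; pose c := u@_(mlead f) / f@_(mlead f).
exists c; apply/eqP; rewrite -subr_eq0; set w := u - _.
pose w' := v - c *: g.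
have cross : w * g = w' * f.
  by rewrite !mulrBl ugvf -!scalerAl [f * g]mulrC.
have [//|w0] := eqVneq w 0.
have w'0 : w' != 0.
  by apply: contraNneq w0 => w'0; have /eqP := cross;
     rewrite w'0 mul0r mulf_eq0 (negPf g0) orbF.
have wd : (mdeg (mlead w) <= d)%N.
  rewrite -ltnS mlead_deg // msize_leB // msize_leZ // -mlead_deg // fm.
  by rewrite mdeg_bimon addn0.
have := congr1 (fun p : bipoly R => mlead p 0) cross.
rewrite /= !mleadM // fm gm [LHS]mnmDE [RHS]mnmDE !bimon0 addn0 => w0d.
have wm : mlead w = bimon d 0.
  have : (d <= mlead w 0%R)%N by rewrite w0d leq_addl.
  move: wd; rewrite [in mdeg _](bimonE (mlead w)) mdeg_bimon => le1 le2.
  have w1 : mlead w 1%R = 0%N.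
    apply/eqP; rewrite -leqn0 -(leq_add2l (mlead w 0%R)) addn0.
    exact: leq_trans le1 le2.
  move: le1; rewrite w1 addn0 => le1; rewrite [LHS]bimonE w1.
  by congr bimon; apply/eqP; rewrite eqn_leq le1.
suff : w@_(mlead w) = 0 by move/eqP; rewrite mleadc_eq0 (negPf w0).
rewrite wm mcoeffB mcoeffZ /c fm divfK ?subrr //.
by rewrite -fm mleadc_eq0.
Qed.

(** The cross relations are bilinear, so they pass to equal combinations of the [u l] and the [h l].
    Combinations of [h] with coprime leading monomials then produce the constant, and cancelling one
    of them carries it to every index. *)
Lemma basis_cross_proportional n Y (h u : 'I_n.+2 -> bipoly R) :
  unisolvent n.+1 Y -> is_basis (Pi_ n.+1 `&` ideal Y)%classic h ->
  (forall l, (msize (u l) <= n.+2)%N) ->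
  (forall l m, u l * h m = u m * h l) ->
  exists c, forall l, u l = c *: h l.
Proof.
move=> hY [_ _ hspan] un cross; have [H HP] := leading_family_ex hY.
pose comb (a : 'I_n.+2 -> R) (b : 'I_n.+2 -> bipoly R) := \sum_l a l *: b l.
have combM a b p : comb a b * p = \sum_l a l *: (b l * p).
  by rewrite mulr_suml; apply: eq_bigr => l _; rewrite scalerAl.
have lead (l : 'I_n.+2) : exists a,
    comb a h != 0 /\ mlead (comb a h) = bimon l (n.+1 - l).
  have [|a aE] := hspan (H l).
    by split; [exact: (leading_family_msize HP) | have [] := HP l].
  exists a; rewrite /comb -aE; apply: mlead_leading.
  by rewrite mdeg_bimon_ord; have [] := HP l.
have cross1 a m : comb a u * h m = u m * comb a h.
  rewrite combM [RHS]mulrC combM; apply: eq_bigr => l _.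
  by rewrite cross mulrC.
(* The extreme indices give the pure powers of [X_0] and [X_1] of degree n+1. *)
have [a []] := lead ord_max; have [b []] := lead ord0.
rewrite /= subnn subn0 => g0 gm f0 fm.
have ua : (msize (comb a u) <= n.+2)%N.
  by apply: msize_le_sum => l; apply: msize_leZ.
have ab : comb a u * comb b h = comb b u * comb a h.
  rewrite mulrC [RHS]combM combM; apply: eq_bigr => l _.
  by rewrite mulrC cross1.
have [c ac] := cross_proportional f0 g0 fm gm ua ab.
exists c => l; apply: (mulIf f0).
by rewrite -cross1 ac -scalerAl mulrC scalerAl.
Qed.

Lemma msize_prod_linear n m (F : 'I_m -> {mpoly R[n]}) :
  (forall i, msize (F i) <= 2)%N -> (msize (\prod_i F i) <= m.+1)%N.
Proof.
elim: m F => [|m IHm] F F2; first by rewrite big_ord0 msize1.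
by rewrite big_ord_recl; apply: (@msize_leM _ _ _ _ 1 m) => //; apply: IHm.
Qed.

Lemma msize_det_linear n m (A : 'M[{mpoly R[n]}]_m) :
  (forall i j, msize (A i j) <= 2)%N -> (msize (\det A) <= m.+1)%N.
Proof.
move=> A2; apply: msize_le_sum => s; rewrite mulr_sign.
by case: ifP => _; rewrite ?msizeN; apply: msize_prod_linear => i; apply: A2.
Qed.

Lemma certificate_maximal_line n Y h Sigma k i j :
  unisolvent n.+1 Y -> @maximal_line_certificate R n Y h Sigma k i j ->
  maximal_line n Y (zero_set k).
Proof.
move=> hY [hb [S2 Sh] rkS k2 Sj]; split; first by exists k.
have [hI hfree _] := hb.
have cross l m : maxminor Sigma l * h m = maxminor Sigma m * h l.
  have := @maxminor_cross _ _ Sigma (\col_l h l) _ l m.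
  rewrite !mxE; apply; apply/colP => r; rewrite !mxE -[RHS](Sh r).
  by apply: eq_bigr => l' _; rewrite mxE.
have minor_size l : (msize (maxminor Sigma l) <= n.+2)%N.
  rewrite /maxminor -signr_odd mulr_sign.
  have : (msize (\det (col' l Sigma)) <= n.+2)%N.
    by apply: msize_det_linear => r s; rewrite mxE; apply: S2.
  by case: ifP; rewrite ?msizeN.
have [c cE] := basis_cross_proportional hY hb minor_size cross.
have c0 : c != 0.
  have [l] := maxminor_neq0 rkS; apply: contraNneq => c0.
  by rewrite cE c0 scale0r.
(* The minors at indices other than [j] are multiples of [k]; dividing by the constant [c] transfers
   this to [h]. *)
have /choice[q hq] : forall l, exists q, h (lift j l) = k * q.
  move=> l; have [|j' _] := maxminor_col Sj (l := lift j l).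
    by rewrite eq_sym neq_lift.
  rewrite cE => /(congr1 (fun p => c^-1 *: p)).
  by rewrite scalerA mulVf // scale1r scalerAr => ->; eexists.
have hN0 l : h l != 0.
  apply/eqP => hl0; have /hfree/(_ l)/eqP : \sum_m (m == l)%:R *: h m = 0.
    rewrite (bigD1 l) //= hl0 scaler0 add0r.
    by apply: big1 => m /negPf ->; rewrite scale0r.
  by rewrite eqxx oner_eq0.
apply: (card_on_line (q := q)) => // [l|d d0 l|l].
- have [/= + _] := hI (lift j l); rewrite /Pi_ /= hq.
  have q0 : q l != 0.
    by apply: contraNneq (hN0 (lift j l)) => q0; rewrite hq q0 mulr0.
  by rewrite msizeM // ?degree1_neq0 // k2.
(* Extending [d] by 0 at [j] turns a relation among the [q l], multiplied by [k], into a relation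
   among the [h m]. The next line exposes [d l] as [d'] at [lift j l]. *)
- pose d' m := if unlift j m is Some l' then d l' else 0.
  rewrite -[LHS]/(oapp d 0 (Some l)) -(liftK j l).
  apply: (hfree d'); rewrite (bigD1_ord j) //= /d' unlift_none scale0r add0r.
  under eq_bigr do rewrite liftK hq scalerAr.
  by rewrite -mulr_sumr d0 mulr0.
- by rewrite -hq; have [] := hI (lift j l).
Qed.

(** * From a maximal line to a certificate *)

Lemma is_basis_change (L : lmodType R) (V : set L) m (b : 'I_m -> L)
    (U : 'M[R]_m) :
  (forall a, (forall i, V (b i)) -> V (\sum_i a i *: b i)) ->
  U \in unitmx -> is_basis V b -> is_basis V (fun i => \sum_j U i j *: b j).
Proof.
move=> Vlin Uu [bV bfree bspan].
(* Coordinates [c] in the new family are coordinates [c U] in the old one, so independence and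
   spanning transfer through the inverse of [U]. *)
have chg (c : 'I_m -> R) : \sum_i c i *: (\sum_j U i j *: b j) =
    \sum_j ((\row_i c i) *m U) 0 j *: b j.
  under eq_bigr do rewrite scaler_sumr.
  rewrite exchange_big; apply: eq_bigr => j _; rewrite mxE scaler_suml.
  by apply: eq_bigr => i _; rewrite mxE scalerA.
split=> [i|c|v /bspan[c ->]].
- exact: Vlin.
- rewrite chg => /bfree c0.
  have cU : (\row_i c i) *m U = 0 by apply/rowP => j; rewrite c0 mxE.
  have : \row_i c i = 0 by rewrite -(mulmxK Uu (\row_i c i)) cU mul0mx.
  by move=> /rowP r0 i; have := r0 i; rewrite !mxE.
- exists (fun i => ((\row_i c i) *m invmx U) 0 i).
  rewrite chg; apply: eq_bigr => j _; congr (_ *: _).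
  have -> : \row_i ((\row_i c i) *m invmx U) 0 i = (\row_i c i) *m invmx U.
    by apply/rowP => i; rewrite mxE.
  by rewrite mulmxKV // mxE.
Qed.

(* Setting [X_0 = 0] turns this matrix into a characteristic matrix. *)
Lemma linear_pencil_det_neq0 n (C : 'M[R]_n) (e : 'I_n -> 'I_n -> bool) :
  \det (\matrix_(i, l) ('X_1 *+ (l == i) - 'X_0 *+ e i l
                        - (C i l)%:MP : bipoly R)) != 0.
Proof.
pose phi : {rmorphism bipoly R -> {poly R}} :=
  @mmap 2 R {poly R} polyC (fun i => if i == 1 then 'X else 0).
apply: contra_neq (monic_neq0 (char_poly_monic C)).
move=> /(congr1 phi); rewrite rmorph0 -det_map_mx => <-.
rewrite /char_poly; congr (\det _); apply/matrixP => i l; rewrite !mxE.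
rewrite !rmorphB !rmorphMn /= !mmapX !mmap1U mmapC /= mul0rn subr0.
by rewrite eq_sym.
Qed.

(** In blocks, the first row is [k, -s] and the rows below are [0, S]. The first row encodes
    [k h_0 = sum_l s_l (k q_l)]; the others are syzygies of the [q l]. *)
Definition line_syzygies n (k : bipoly R) (s : 'I_n.+1 -> bipoly R)
    (S : 'M[bipoly R]_(n, n.+1)) : 'M[bipoly R]_(n.+1, n.+2) :=
  \matrix_(i, j) match unlift 0 i, unlift 0 j with
                 | None, None => k
                 | None, Some l => - s l
                 | Some _, None => 0
                 | Some r, Some l => S r l
                 end.

(** The first column forces the first entry of a left kernel vector to be zero; the invertible
    square block of [S] then kills the rest. *)
Lemma line_syzygies_rank n k (s : 'I_n.+1 -> bipoly R)
    (S : 'M[bipoly R]_(n, n.+1)) :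
  k != 0 -> \det (\matrix_(i < n, l < n) S i (lift 0 l)) != 0 ->
  frac_rank (line_syzygies k s S) = n.+1.
Proof.
move=> k0 dS; apply/eqP; apply: inj_row_free => v vS.
have v0 : v 0 0 = 0.
  have /rowP/(_ 0) := vS; rewrite !mxE (bigD1_ord 0) //= !mxE !unlift_none.
  rewrite big1 ?addr0 => [/eqP|i _]; last first.
    by rewrite !mxE liftK unlift_none rmorph0 mulr0.
  by rewrite mulf_eq0 tofrac_eq0 (negPf k0) orbF => /eqP.
pose S' := map_mx (@tofrac (bipoly R)) (\matrix_(i < n, l < n) S i (lift 0 l)).
have S'u : S' \in unitmx by rewrite unitmxE unitfE det_map_mx tofrac_eq0.
have v'S : (\row_i v 0 (lift 0 i)) *m S' = 0.
  apply/rowP => l; have /rowP/(_ (lift 0 (lift 0 l))) := vS.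
  rewrite !mxE (bigD1_ord 0) //= v0 mul0r add0r => vl; rewrite -[RHS]vl.
  by apply: eq_bigr => i _; rewrite !mxE !liftK.
have v'0 : \row_i v 0 (lift 0 i) = 0.
  by rewrite -(mulmxK S'u (\row_i _)) v'S mul0mx.
apply/rowP => i; rewrite mxE; case: (unliftP 0 i) => [i'|] ->; last by [].
by have /rowP/(_ i') := v'0; rewrite !mxE.
Qed.

Lemma maximal_line_certificate_ex n Y k :
  unisolvent n.+1 Y -> degree1 k -> #|` on_line Y k| = n.+1 ->
  exists h Sigma, @maximal_line_certificate R n Y h Sigma k 0 0.
Proof.
move=> hY k2 cK; pose Z := (Y `\` on_line Y k)%fset.
have k0 := degree1_neq0 k2.
(* Removing n+1 points from [Y] leaves exactly as many points as there are monomials of degree less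
   than n. *)
have hZ : unisolvent n Z.
  apply: unisolvent_inj; first exact: off_line_inj.
  rewrite -(leq_add2l n.+1) -{1}cK card_off_line (unisolvent_card hY).
  by rewrite card_bimonS addnC.
have [q qP] := leading_family_ex hZ; have [H HP] := leading_family_ex hY.
have kqY l : ideal Y (k * q l).
  move=> y /= yY; have [qZ _] := qP l; rewrite pevalM.
  have [->|ky] := eqVneq (peval k y) 0; first by rewrite mul0r.
  by rewrite qZ ?mulr0 //= in_fsetD in_on_line yY (negPf ky).
have kq_size l : (msize (k * q l) <= n.+2)%N.
  by apply: (@msize_leM _ _ _ _ 1 n); rewrite ?k2 // (leading_family_msize qP).
(* Row [l] holds the coordinates of [k * q l] in the basis [H]. *)
pose C := \matrix_(l < n.+1, m < n.+2) (k * q l)@_(bimon m (n.+1 - m)).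
have Cfree : row_free C.
  apply: inj_row_free => v vC.
  have /mulfI kI := k0.
  have /kI : k * (\sum_l v 0 l *: q l) = k * 0.
    rewrite mulr0 mulr_sumr; under eq_bigr do rewrite -scalerAr.
    under eq_bigr do
      rewrite (leading_family_span hY HP (kq_size _) (kqY _)) scaler_sumr.
    rewrite exchange_big big1 // => m _.
    under eq_bigr do rewrite scalerA.
    rewrite -scaler_suml; have /rowP/(_ m) := vC; rewrite !mxE.
    by under eq_bigr do rewrite mxE; move=> ->; rewrite scale0r.
  have [_ qfree _] := leading_family_basis hZ qP.
  by move=> /qfree v0; apply/rowP => l; rewrite v0 mxE.
(* The completing row [w] defines [h 0]; the rows of [C] give the remaining [k * q l]. *)
have [w Uu] := row_free_complete Cfree.
set U : 'M_n.+2 := col_mx w C in Uu.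
pose h (i : 'I_n.+2) := \sum_m U i m *: H m.
have hk l : h (lift 0 l) = k * q l.
  rewrite [RHS](leading_family_span hY HP (kq_size l) (kqY l)).
  apply: eq_bigr => m _; congr (_ *: _); rewrite /U -rshift1.
  by rewrite [LHS](@col_mxEd _ 1) mxE.
have hb : is_basis (Pi_ n.+1 `&` ideal Y)%classic h.
  apply: is_basis_change (leading_family_basis hY HP) => // a HV; split.
    by apply: msize_le_sum => l; apply: msize_leZ; have [] := HV l.
  by apply: vanishing_sum => l; have [] := HV l.
have [hI _ _] := hb.
(* Since [h 0] has degree at most n+1 and vanishes on [Z], it is a combination of the [q l] with
   linear coefficients. *)
have [s s2 sE] : exists2 s : 'I_n.+1 -> bipoly R,
    forall l, (msize (s l) <= 2)%N & h 0 = \sum_l s l * q l.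
  have [h0 hY0] := hI 0; apply: (leading_family_spanS hZ qP) => // y.
  by rewrite /= in_fsetD => /andP[_]; apply: hY0.
have [D DE] := leading_family_syzygy hZ qP.
pose S : 'M[bipoly R]_(n, n.+1) := \matrix_(i, l)
  ('X_1 *+ (l == lift 0 i) - 'X_0 *+ (l == widen_ord (leqnSn n) i)
   - (D i l)%:MP).
exists h, (line_syzygies k s S); split=> //.
- split=> i; last first.
    rewrite /syzygy (bigD1_ord 0) //= mxE unlift_none.
    under eq_bigr do rewrite mxE liftK hk mulrCA.
    rewrite -mulr_sumr; case: unliftP => [r|] _.
      under eq_bigr do rewrite mxE.
      by rewrite DE mul0r mulr0 addr0.
    rewrite sE -mulrDr -big_split big1 ?mulr0 // => l _.
    by rewrite /= mulNr subrr.
  move=> j; rewrite mxE /Pi_ /=.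
  case: unliftP => [r|] _; case: unliftP => [l|] _.
  + rewrite mxE !msize_leB //; last by rewrite msizeC; case: eqP.
    * by case: eqP; rewrite ?mulr1n ?mulr0n ?msizeX ?mdeg1 ?msize0.
    * by case: eqP; rewrite ?mulr1n ?mulr0n ?msizeX ?mdeg1 ?msize0.
  + by rewrite msize0.
  + by rewrite msizeN.
  + by rewrite k2.
- apply: line_syzygies_rank => //.
  (* Once column 0 of [S] is deleted, the [X_1] terms lie exactly on the diagonal. *)
  have := linear_pencil_det_neq0 (\matrix_(i, l) D i (lift 0 l))
    (fun i l => lift 0 l == widen_ord (leqnSn n) i).
  congr (\det _ != 0); apply/matrixP => i l; rewrite !mxE.
  by rewrite (inj_eq lift_inj).
- apply/colP => i; rewrite !mxE unlift_none andbT.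
  case: unliftP => [r|] ->.
    by rewrite eq_sym (negPf (neq_lift _ _)) mulr0.
  by rewrite eqxx mulr1.
Qed.

End MaximalLines.

Theorem theorem4p4 (R : realType) (n : nat) (Y : {fset plane R})
    (hY : poised n Y) :
  ((exists K : set (plane R), maximal_line n Y K) <->
   (exists (h : 'I_n.+2 -> bipoly R) (Sigma : 'M[bipoly R]_(n.+1, n.+2))
      (k : bipoly R) (i : 'I_n.+1) (j : 'I_n.+2),
      maximal_line_certificate Y h Sigma k i j)) /\
  (forall (h : 'I_n.+2 -> bipoly R) (Sigma : 'M[bipoly R]_(n.+1, n.+2))
     (k : bipoly R) (i : 'I_n.+1) (j : 'I_n.+2),
     maximal_line_certificate Y h Sigma k i j ->
     maximal_line n Y (zero_set k)).
Proof.
have hU := poised_unisolvent hY.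
split; last by move=> h S k i j; apply: certificate_maximal_line.
split=> [[K [[k k2 ->] cK]]|[h [S [k [i [j hc]]]]]].
  have [h [S hc]] := maximal_line_certificate_ex hU k2 cK.
  by exists h, S, k, 0%R, 0%R.
by exists (zero_set k); apply: certificate_maximal_line hc.
Qed.
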